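(* Let $\Bbbk$ be a field and $A$ a finite-dimensional $\Bbbk$-algebra. The $\Bbbk$-linear equivalence $F_A:\mathsf{Klcrep}(A)\to\mathsf{rep}(A)$ restricts to an equivalence $$\mathsf{Klcrep}^{\mathrm{inj}}(A)\simeq\mathsf{inj}(A),$$ where $\mathsf{Klcrep}^{\mathrm{inj}}(A)$ is the full subcategory of injective Kleisli convolution representations of $A$ and $\mathsf{inj}(A)$ is the category of finite-dimensional injective left $A$-modules.
   Context: $A$ is associative with identity; $\mathsf{rep}(A)$ is the category of finite-dimensional left $A$-modules. Let $\mathbf 1=\{\bullet\}$, and for a finite set $X$ put $E_X=X\times X$. For a set $X$, $\mathcal M_{\Bbbk}(X)$ is the $\Bbbk$-vector space of finite formal sums $\sum_{x\in X}a_x[x]$; $\mathscr M_{\Bbbk}$ is the corresponding free $\Bbbk$-module monad on $\mathsf{Set}$ (unit $x\mapsto[x]$, multiplication given by expanding formal sums of formal sums). A Kleisli arrow $f:X\rightsquigarrow Y$ is a map $f:X\to\mathcal M_{\Bbbk}(Y)$, $f(x)=\sum_y f_{y,x}[y]$, with matrix $[f]=(f_{y,x})$; Kleisli composition satisfies $[h\circ_{\mathsf{Kl}}f]=[h][f]$. For finite $X$, $\mathbb H_{\Bbbk}(X)=\mathrm{Hom}_{\mathsf{Kl}(\mathscr M_{\Bbbk})}(\mathbf 1,E_X)$ is a unital $\Bbbk$-algebra with pointwise linear structure and Kleisli convolution as multiplication: if $f(\bullet)=\sum f_{i,j}[(i,j)]$ and $g(\bullet)=\sum g_{i,j}[(i,j)]$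 then $(f\ast g)(\bullet)=\sum_{i,q}(\sum_j f_{i,j}g_{j,q})[(i,q)]$; its unit is $u_X(\bullet)=\sum_x[(x,x)]$. $\Phi_X:\mathbb H_{\Bbbk}(X)\to\mathrm{Mat}_X(\Bbbk)$, $f\mapsto(f_{i,j})$, is an isomorphism of $\Bbbk$-algebras. A Kleisli convolution representation of $A$ is a pair $(X,\theta)$ with $X$ a finite set and $\theta:A\to\mathbb H_{\Bbbk}(X)$ a unital $\Bbbk$-algebra homomorphism. A homomorphism $(X,\theta_X)\to(Y,\theta_Y)$ is a Kleisli arrow $f:X\rightsquigarrow Y$ with $\Phi_Y(\theta_Y(a))[f]=[f]\Phi_X(\theta_X(a))$ for all $a\in A$. These form the $\Bbbk$-linear category $\mathsf{Klcrep}(A)$ under Kleisli composition. The functor $F_A$ sends $(X,\theta)$ to $\mathcal M_{\Bbbk}(X)$ with action $a\cdot v=\Phi_X(\theta(a))v$, and sends $f$ to the linear map $[x]\mapsto f(x)$; it is a $\Bbbk$-linear equivalence. An object $(X,\theta)$ is an injective Kleisli convolution representation if $F_A(X,\theta)$ is an injective left $A$-module. *)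

(* Defs.v *)
From HB Require Import structures.
From mathcomp Require Import all_boot all_order all_algebra finmap.
From mathcomp Require Import boolp.
From mathcomp Require Import monalg.

Set Implicit Arguments.
Unset Strict Implicit.
Unset Printing Implicit Defensive.

Import GRing.Theory.
Local Open Scope ring_scope.
Local Obligation Tactic := idtac.

Record lincat (k : fieldType) := LinCat {
  obj :> Type;
  hom : obj -> obj -> lmodType k;
  idm : forall x, hom x x;
  comp : forall x y z, hom y z -> hom x y -> hom x z;
  comp1m : forall x y (f : hom x y), comp (idm y) f = f;
  compm1 : forall x y (f : hom x y), comp f (idm x) = f;
  compA : forall x y z t (h : hom z t) (g : hom y z) (f : hom x y),
    comp h (comp g f) = comp (comp h g) f;
  comp_linear_l : forall x y z (f : hom x y),
    linear (fun g : hom y z => comp g f);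
  comp_linear_r : forall x y z (g : hom y z),
    linear (fun f : hom x y => comp g f)
}.
Arguments hom {k l}.
Arguments idm {k l}.
Arguments comp {k l x y z}.

Declare Scope lincat_scope.
Delimit Scope lincat_scope with lincat.
Notation "g \oc f" := (comp g f)
  (at level 50, left associativity) : lincat_scope.
Local Open Scope lincat_scope.

Record linfunctor (k : fieldType) (C D : lincat k) := LinFunctor {
  fobj :> C -> D;
  fmor : forall x y : C, hom x y -> hom (fobj x) (fobj y);
  fmor_linear : forall x y : C, linear (@fmor x y);
  fmor1 : forall x : C, fmor (idm x) = idm (fobj x);
  fmorM : forall (x y z : C) (g : hom y z) (f : hom x y),
    fmor (g \oc f) = fmor g \oc fmor f
}.
Arguments fmor {k C D} l {x y}.

Section Functors.
Context {k : fieldType}.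
Implicit Types C D E : lincat k.

Program Definition id_functor C : linfunctor C C :=
  @LinFunctor k C C id (fun x y f => f) _ _ _.
Solve All Obligations with by [].

Program Definition comp_functor C D E (G : linfunctor D E)
    (F : linfunctor C D) : linfunctor C E :=
  @LinFunctor k C E (fun x => G (F x)) (fun x y f => fmor G (fmor F f)) _ _ _.
Next Obligation. by move=> C D E G F x y a f g /=; rewrite !fmor_linear. Qed.
Next Obligation. by move=> C D E G F x /=; rewrite !fmor1. Qed.
Next Obligation. by move=> C D E G F x y z g f /=; rewrite !fmorM. Qed.

Definition is_iso C (x y : C) (f : hom x y) : Prop :=
  exists g : hom y x, g \oc f = idm x /\ f \oc g = idm y.

Definition naturally_isomorphic C D (F G : linfunctor C D) : Prop :=
  exists eta : forall x : C, hom (F x) (G x),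
    (forall x, is_iso (eta x)) /\
    (forall (x y : C) (f : hom x y), eta y \oc fmor F f = fmor G f \oc eta x).

Definition is_equivalence C D (F : linfunctor C D) : Prop :=
  exists G : linfunctor D C,
    naturally_isomorphic (comp_functor G F) (id_functor C) /\
    naturally_isomorphic (comp_functor F G) (id_functor D).

Section FullSubcategory.
Variables (C : lincat k) (P : C -> Prop).

Definition full_subcat : lincat k :=
  @LinCat k {x : C | P x}
    (fun x y => hom (sval x) (sval y))
    (fun x => idm (sval x))
    (fun x y z g f => g \oc f)
    (fun x y f => comp1m f)
    (fun x y f => compm1 f)
    (fun x y z t h g f => compA h g f)
    (fun x y z f => @comp_linear_l k C _ _ _ f)
    (fun x y z g => @comp_linear_r k C _ _ _ g).
End FullSubcategory.

Definition restrict_functor C D (F : linfunctor C D) (P : C -> Prop)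
    (Q : D -> Prop) (PQ : forall x, P x -> Q (F x)) :
    linfunctor (full_subcat P) (full_subcat Q) :=
  @LinFunctor k (full_subcat P) (full_subcat Q)
    (fun x => exist Q (F (sval x)) (PQ _ (svalP x)))
    (fun x y f => fmor F f)
    (fun x y => @fmor_linear k C D F _ _)
    (fun x => fmor1 F _)
    (fun x y z g f => fmorM F g f).

End Functors.
Arguments restrict_functor {k C D} F {P Q} PQ.

(* An associative unital k-algebra: a ring with a ring morphism from k to its
   center.  The library's [algType] is not used because it excludes the zero
   ring. *)
Record algebra (k : fieldType) := Algebra {
  alg_ring :> pzRingType;
  alg_scalar : {rmorphism k -> alg_ring};
  alg_scalarC : forall c x, alg_scalar c * x = x * alg_scalar c
}.

Definition finite_dimensional (k : fieldType) (V : lmodType k) : Prop :=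
  exists n, inhabited (Vector.axiom n V).

Definition injective_module (R : pzRingType) (Q : lmodType R) : Prop :=
  forall (M N : lmodType R) (i : {linear M -> N}) (f : {linear M -> Q}),
    injective i -> exists g : {linear N -> Q}, forall x, g (i x) = f x.

Section Modules.
Context {k : fieldType} {A : algebra k}.

(* An A-module seen as a k-vector space along the structure map k -> A. *)
Definition scalar_restriction (M : lmodType A) : Type := M.

Section ScalarRestriction.
Variable M : lmodType A.
Local Notation V := (scalar_restriction M).

HB.instance Definition _ := GRing.Zmodule.copy V M.

Definition restricted_scale (c : k) (v : V) : V :=
  (alg_scalar A c *: (v : M) : M).

Fact restricted_scaleA a b v :
  restricted_scale a (restricted_scale b v) = restricted_scale (a * b) v.
Proof. by rewrite /restricted_scale scalerA rmorphM. Qed.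
Fact restricted_scale1 : left_id 1 restricted_scale.
Proof. by move=> v; rewrite /restricted_scale rmorph1 scale1r. Qed.
Fact restricted_scaleDr : right_distributive restricted_scale +%R.
Proof. by move=> a u v; rewrite /restricted_scale scalerDr. Qed.
Fact restricted_scaleDl v : {morph restricted_scale^~ v : a b / a + b}.
Proof. by move=> a b; rewrite /restricted_scale rmorphD scalerDl. Qed.

HB.instance Definition _ := GRing.Zmodule_isLmodule.Build k V
  restricted_scaleA restricted_scale1 restricted_scaleDr restricted_scaleDl.
End ScalarRestriction.

Definition module_hom (M N : lmodType A) : Type := {linear M -> N}.

Section ModuleHom.
Variables M N : lmodType A.
Implicit Types f g : module_hom M N.

Lemma module_homP f g : (f : M -> N) =1 (g : M -> N) -> f = g.
Proof.
case: f g => [f [[a] [b]]] [g [[a'] [b']]] /= /funext E.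
by case: g / E a' b' => a' b'; congr (GRing.Linear.Pack (GRing.Linear.Class _ _));
  [congr GRing.isNmodMorphism.Axioms_ | congr GRing.isScalable.Axioms_];
  exact: Prop_irrelevance.
Qed.

HB.instance Definition _ := gen_eqMixin (module_hom M N).
HB.instance Definition _ := gen_choiceMixin (module_hom M N).

Program Definition module_hom_zero : module_hom M N :=
  GRing.Linear.clone A M N _ (\0 : M -> N) _.
Program Definition module_hom_add f g : module_hom M N :=
  GRing.Linear.clone A M N _ (f \+ g : M -> N) _.
Program Definition module_hom_opp f : module_hom M N :=
  GRing.Linear.clone A M N _ (\- f : M -> N) _.

(* c acts on Hom_A(M, N) pointwise through k -> A, whose image is central. *)
Definition module_hom_scale_fun (c : k) f : M -> N :=
  fun v => alg_scalar A c *: f v.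
Fact module_hom_scale_linear c f : linear (module_hom_scale_fun c f).
Proof.
move=> a u v; rewrite /module_hom_scale_fun linearP scalerDr !scalerA.
by rewrite alg_scalarC.
Qed.
HB.instance Definition _ c f :=
  GRing.isLinear.Build A M N *:%R (module_hom_scale_fun c f)
    (module_hom_scale_linear c f).
Definition module_hom_scale c f : module_hom M N :=
  module_hom_scale_fun c f : {linear M -> N}.

Fact module_hom_addA : associative module_hom_add.
Proof. by move=> f g h; apply: module_homP => v; exact: addrA. Qed.
Fact module_hom_addC : commutative module_hom_add.
Proof. by move=> f g; apply: module_homP => v; exact: addrC. Qed.
Fact module_hom_add0 : left_id module_hom_zero module_hom_add.
Proof. by move=> f; apply: module_homP => v; exact: add0r. Qed.
Fact module_hom_addN :
  left_inverse module_hom_zero module_hom_opp module_hom_add.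
Proof. by move=> f; apply: module_homP => v; exact: addNr. Qed.
HB.instance Definition _ := GRing.isZmodule.Build (module_hom M N)
  module_hom_addA module_hom_addC module_hom_add0 module_hom_addN.

Fact module_hom_scaleA a b f :
  module_hom_scale a (module_hom_scale b f) = module_hom_scale (a * b) f.
Proof.
apply: module_homP => v /=; rewrite /module_hom_scale_fun /=.
by rewrite /module_hom_scale_fun scalerA rmorphM.
Qed.
Fact module_hom_scale1 : left_id 1 module_hom_scale.
Proof.
by move=> f; apply: module_homP => v /=; rewrite /module_hom_scale_fun rmorph1 scale1r.
Qed.
Fact module_hom_scaleDr : right_distributive module_hom_scale +%R.
Proof.
move=> a f g; apply: module_homP => v /=.
by rewrite /module_hom_scale_fun /= scalerDr.
Qed.
Fact module_hom_scaleDl f : {morph module_hom_scale^~ f : a b / a + b}.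
Proof.
move=> a b; apply: module_homP => v /=.
by rewrite /module_hom_scale_fun /= rmorphD scalerDl.
Qed.
HB.instance Definition _ := GRing.Zmodule_isLmodule.Build k (module_hom M N)
  module_hom_scaleA module_hom_scale1 module_hom_scaleDr module_hom_scaleDl.
End ModuleHom.

Definition module_hom_id (M : lmodType A) : module_hom M M := @idfun M.
Definition module_hom_comp (M N P : lmodType A) (g : module_hom N P)
  (f : module_hom M N) : module_hom M P := g \o f.
End Modules.

Definition finite_dimensional_algebra (k : fieldType) (A : algebra k) : Prop :=
  finite_dimensional (scalar_restriction (A^o : lmodType A)).

Section Rep.
Context {k : fieldType} (A : algebra k).

Record rep_obj := RepObj {
  rep_module :> lmodType A;
  rep_findim : finite_dimensional (scalar_restriction rep_module)
}.

Program Definition rep : lincat k :=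
  @LinCat k rep_obj (fun M N => module_hom M N)
    (fun M => module_hom_id M)
    (fun M N P g f => module_hom_comp g f) _ _ _ _ _.
Next Obligation. by move=> M N f; apply: module_homP. Qed.
Next Obligation. by move=> M N f; apply: module_homP. Qed.
Next Obligation. by move=> M N P Q h g f; apply: module_homP. Qed.
Next Obligation. by move=> M N P f a g h; apply: module_homP. Qed.
Next Obligation.
move=> M N P g a f h; apply: module_homP => v /=.
by rewrite linearP.
Qed.

Definition is_injective_rep (M : rep) : Prop :=
  injective_module (rep_module M).

Definition inj : lincat k := full_subcat is_injective_rep.
End Rep.

Section Kleisli.
Context {k : fieldType}.

(* M_k(X) is the library's [{malg k[X]}], with v@_x the coefficient of [x] in v
   and << c *g x >> the formal sum c[x]. *)

(* Kleisli extension: linear extension of X -> M_k(Y) to M_k(X) -> M_k(Y). *)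
Definition kl_bind (X Y : choiceType) (f : X -> {malg k[Y]})
    (v : {malg k[X]}) : {malg k[Y]} :=
  \sum_(x <- msupp v) v@_x *: f x.

Definition kl_arrow (X : finType) (Y : choiceType) : Type :=
  {ffun X -> {malg k[Y]}}.
HB.instance Definition _ (X : finType) (Y : choiceType) :=
  GRing.Lmodule.copy (kl_arrow X Y) {ffun X -> {malg k[Y]}}.

Definition kl_id (X : finType) : kl_arrow X X := [ffun x => << x >>].

Definition kl_comp (X Y : finType) (Z : choiceType)
    (h : kl_arrow Y Z) (f : kl_arrow X Y) : kl_arrow X Z :=
  [ffun x => kl_bind h (f x)].

(* Matrices indexed by finite sets are library matrices, a finite set X being
   enumerated by [enum_val : 'I_#|X| -> X]. *)
Definition kl_mx (X Y : finType) (f : kl_arrow X Y) : 'M[k]_(#|Y|, #|X|) :=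
  \matrix_(i, j) (f (enum_val j))@_(enum_val i).

Definition coords (X : finType) (v : {malg k[X]}) : 'cV[k]_#|X| :=
  \col_i v@_(enum_val i).

Definition of_coords (X : finType) (w : 'cV[k]_#|X|) : {malg k[X]} :=
  \sum_x << w (enum_rank x) 0 *g x >>.

Lemma coordsK (X : finType) : cancel (@coords X) (@of_coords X).
Proof.
move=> v; apply/malgP=> x; rewrite /of_coords raddf_sum /= (bigD1 x) //=.
rewrite mcoeffUU mxE enum_rankK big1 ?addr0 // => y /negPf nyx.
by rewrite mcoeffU nyx mulr0n.
Qed.

Lemma of_coordsK (X : finType) : cancel (@of_coords X) (@coords X).
Proof.
move=> w; apply/colP=> i; rewrite mxE /of_coords raddf_sum /=.
rewrite (bigD1 (enum_val i)) //= mcoeffUU enum_valK big1 ?addr0 // => y ny.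
by rewrite mcoeffU (negPf ny) mulr0n.
Qed.

Lemma coords_is_linear (X : finType) : linear (@coords X).
Proof. by move=> a u v; apply/colP=> i; rewrite !mxE mcoeffD mcoeffZ. Qed.
HB.instance Definition _ (X : finType) :=
  GRing.isLinear.Build k {malg k[X]} 'cV[k]_#|X| *:%R (@coords X)
    (@coords_is_linear X).

Lemma kl_bindE (X : finType) (Y : choiceType) (f : X -> {malg k[Y]}) v :
  kl_bind f v = \sum_x v@_x *: f x.
Proof.
rewrite /kl_bind big_uniq ?fset_uniq //= [RHS](bigID [in msupp v]) /=.
rewrite [X in _ + X]big1 ?addr0 // => x /mcoeff_outdom ->.
by rewrite scale0r.
Qed.

Lemma coords_bind (X Y : finType) (f : kl_arrow X Y) v :
  coords (kl_bind f v) = kl_mx f *m coords v.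
Proof.
apply/colP=> i; rewrite kl_bindE !mxE raddf_sum /=.
rewrite (reindex (@enum_val X predT)) /=; last exact/onW_bij/enum_val_bij.
by apply: eq_bigr => j _; rewrite mcoeffZ !mxE mulrC.
Qed.

Lemma kl_mx_inj (X Y : finType) : injective (@kl_mx X Y).
Proof.
move=> f g /matrixP fg; apply/ffunP=> x; apply/malgP=> y.
by have := fg (enum_rank y) (enum_rank x); rewrite !mxE !enum_rankK.
Qed.

Lemma kl_mx_is_linear (X Y : finType) : linear (@kl_mx X Y).
Proof.
by move=> a f g; apply/matrixP=> i j; rewrite !mxE !ffunE mcoeffD mcoeffZ.
Qed.
HB.instance Definition _ (X Y : finType) :=
  GRing.isLinear.Build k (kl_arrow X Y) 'M[k]_(#|Y|, #|X|) *:%R (@kl_mx X Y)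
    (@kl_mx_is_linear X Y).

Lemma kl_mx_id (X : finType) : kl_mx (kl_id X) = 1%:M.
Proof.
apply/matrixP=> i j; rewrite !mxE ffunE mcoeffU.
by rewrite (inj_eq enum_val_inj) eq_sym.
Qed.

Lemma kl_mx_comp (X Y Z : finType) (h : kl_arrow Y Z) (f : kl_arrow X Y) :
  kl_mx (kl_comp h f) = kl_mx h *m kl_mx f.
Proof.
apply/matrixP=> i j; have /colP/(_ i) := coords_bind h (f (enum_val j)).
rewrite !mxE ffunE => ->; apply: eq_bigr => l _.
by rewrite !mxE.
Qed.

Definition kl_conv_alg (X : finType) : Type := kl_arrow unit (X * X)%type.

Section Convolution.
Variable X : finType.
Local Notation H := (kl_conv_alg X).
Implicit Types f g h : H.

HB.instance Definition _ :=
  GRing.Lmodule.copy H (kl_arrow unit (X * X)%type).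

Definition conv f g : H :=
  [ffun=> \sum_i \sum_q
     << (\sum_j (f tt)@_(i, j) * (g tt)@_(j, q)) *g (i, q) >>].

Definition conv_one : H := [ffun=> \sum_x << (x, x) >>].

Definition Phi (f : H) : 'M[k]_#|X| :=
  \matrix_(i, j) (f tt)@_(enum_val i, enum_val j).

Lemma Phi_inj : injective Phi.
Proof.
move=> f g /matrixP fg; apply/ffunP=> -[]; apply/malgP=> -[x y].
by have := fg (enum_rank x) (enum_rank y); rewrite !mxE !enum_rankK.
Qed.

Lemma Phi_is_linear : linear Phi.
Proof.
by move=> a f g; apply/matrixP=> i j; rewrite !mxE !ffunE mcoeffD mcoeffZ.
Qed.
HB.instance Definition _ := GRing.isLinear.Build k H 'M[k]_#|X| *:%R Phi
  Phi_is_linear.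

Lemma Phi_conv f g : Phi (conv f g) = Phi f *m Phi g.
Proof.
apply/matrixP=> i q; rewrite !mxE ffunE raddf_sum /= (bigD1 (enum_val i)) //=.
rewrite raddf_sum /= (bigD1 (enum_val q)) //= mcoeffUU.
rewrite [X in _ + X + _]big1 ?addr0; last first.
  by move=> z /negPf nz; rewrite mcoeffU xpair_eqE nz andbF mulr0n.
rewrite [X in _ + X]big1 ?addr0; last first.
  move=> y /negPf ny; rewrite raddf_sum big1 // => z _ /=.
  by rewrite mcoeffU xpair_eqE ny mulr0n.
rewrite (reindex (@enum_val X predT)) /=; last exact/onW_bij/enum_val_bij.
by apply: eq_bigr => j _; rewrite !mxE.
Qed.

Lemma Phi_one : Phi conv_one = 1%:M.
Proof.
apply/matrixP=> i j; rewrite !mxE ffunE raddf_sum /= (bigD1 (enum_val i)) //=.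
rewrite mcoeffU xpair_eqE eqxx /= (inj_eq enum_val_inj) big1 ?addr0 //.
by move=> y /negPf ny; rewrite mcoeffU xpair_eqE ny mulr0n.
Qed.

Lemma PhiD f g : Phi (f + g) = Phi f + Phi g.
Proof. exact: linearD. Qed.

Fact convA : associative conv.
Proof. by move=> f g h; apply: Phi_inj; rewrite !Phi_conv mulmxA. Qed.
Fact conv1l : left_id conv_one conv.
Proof. by move=> f; apply: Phi_inj; rewrite Phi_conv Phi_one mul1mx. Qed.
Fact conv1r : right_id conv_one conv.
Proof. by move=> f; apply: Phi_inj; rewrite Phi_conv Phi_one mulmx1. Qed.
Fact convDl : left_distributive conv +%R.
Proof.
by move=> f g h; apply: Phi_inj; rewrite PhiD !Phi_conv PhiD mulmxDl.
Qed.
Fact convDr : right_distributive conv +%R.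
Proof.
by move=> f g h; apply: Phi_inj; rewrite PhiD !Phi_conv PhiD mulmxDr.
Qed.
HB.instance Definition _ := GRing.Zmodule_isPzRing.Build H
  convA conv1l conv1r convDl convDr.
End Convolution.
End Kleisli.
Arguments kl_arrow : clear implicits.
Arguments kl_conv_alg : clear implicits.

Section Klcrep.
Context {k : fieldType} (A : algebra k).

(* [kl_rep_scalar] is k-linearity, scalars acting on A through k -> A. *)
Record kl_rep := KlRep {
  kl_set : finType;
  kl_theta : {rmorphism A -> kl_conv_alg k kl_set};
  kl_rep_scalar : forall c a,
    kl_theta (alg_scalar A c * a) = c *: kl_theta a
}.

Section Hom.
Variables X Y : kl_rep.

Definition kl_intertwines : {pred kl_arrow k (kl_set X) (kl_set Y)} :=
  fun f => `[< forall a : A,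
    Phi (kl_theta Y a) *m kl_mx f = kl_mx f *m Phi (kl_theta X a) >].

Fact kl_intertwines_submod : subsemimod_closed kl_intertwines.
Proof.
split; first split.
- by apply/asboolP=> a; rewrite linear0 mulmx0 mul0mx.
- move=> f g /asboolP Hf /asboolP Hg; apply/asboolP=> a.
  by rewrite linearD mulmxDr mulmxDl Hf Hg.
- move=> c f /asboolP Hf; apply/asboolP=> a.
  by rewrite linearZ /= -scalemxAr -scalemxAl Hf.
Qed.

Record kl_hom := KlHom {
  kl_hom_arrow :> kl_arrow k (kl_set X) (kl_set Y);
  kl_homP : kl_hom_arrow \in kl_intertwines
}.
HB.instance Definition _ := [isSub for kl_hom_arrow].
HB.instance Definition _ := [Choice of kl_hom by <:].
HB.instance Definition _ := GRing.SubChoice_isSubLmodule.Build k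
  (kl_arrow k (kl_set X) (kl_set Y)) kl_intertwines kl_hom
  kl_intertwines_submod.

Lemma kl_hom_arrowP c (f g : kl_hom) :
  kl_hom_arrow (c *: f + g) = c *: kl_hom_arrow f + kl_hom_arrow g.
Proof. exact: (linearP (val : {linear kl_hom -> _})). Qed.
End Hom.
Arguments kl_intertwines : clear implicits.

Fact kl_id_intertwines X : kl_id (kl_set X) \in kl_intertwines X X.
Proof. by apply/asboolP=> a; rewrite kl_mx_id mulmx1 mul1mx. Qed.

Fact kl_comp_intertwines X Y Z (g : kl_hom Y Z) (f : kl_hom X Y) :
  kl_comp g f \in kl_intertwines X Z.
Proof.
have /asboolP Hg := kl_homP g; have /asboolP Hf := kl_homP f.
by apply/asboolP=> a; rewrite kl_mx_comp mulmxA Hg -mulmxA Hf mulmxA.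
Qed.

Program Definition Klcrep : lincat k :=
  @LinCat k kl_rep (fun X Y => kl_hom X Y)
    (fun X => KlHom (kl_id_intertwines X))
    (fun X Y Z g f => KlHom (kl_comp_intertwines g f)) _ _ _ _ _.
Next Obligation.
by move=> X Y f; apply/val_inj/kl_mx_inj; rewrite /= kl_mx_comp kl_mx_id mul1mx.
Qed.
Next Obligation.
by move=> X Y f; apply/val_inj/kl_mx_inj; rewrite /= kl_mx_comp kl_mx_id mulmx1.
Qed.
Next Obligation.
by move=> X Y Z T h g f; apply/val_inj/kl_mx_inj; rewrite /= !kl_mx_comp mulmxA.
Qed.
Next Obligation.
move=> X Y Z f a g h; apply/val_inj/kl_mx_inj.
rewrite [LHS]kl_mx_comp !kl_hom_arrowP !linearP /= !kl_mx_comp.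
by rewrite mulmxDl scalemxAl.
Qed.
Next Obligation.
move=> X Y Z g a f h; apply/val_inj/kl_mx_inj.
by rewrite [LHS]kl_mx_comp !kl_hom_arrowP !linearP /= !kl_mx_comp.
Qed.

Definition kl_module (X : kl_rep) : Type := {malg k[kl_set X]}.

Section KlModule.
Variable X : kl_rep.
Local Notation M := (kl_module X).

HB.instance Definition _ := GRing.Zmodule.copy M {malg k[kl_set X]}.

Definition kl_act (a : A) (v : M) : M :=
  of_coords (Phi (kl_theta X a) *m coords v).

Lemma coords_act a v : coords (kl_act a v) = Phi (kl_theta X a) *m coords v.
Proof. exact: of_coordsK. Qed.

Fact kl_actA a b v : kl_act a (kl_act b v) = kl_act (a * b) v.
Proof.
apply: (can_inj (@coordsK k _)); rewrite !coords_act mulmxA rmorphM.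
by rewrite -Phi_conv.
Qed.
Fact kl_act1 : left_id 1 kl_act.
Proof.
move=> v; apply: (can_inj (@coordsK k _)).
by rewrite coords_act rmorph1 Phi_one mul1mx.
Qed.
Fact kl_actDr : right_distributive kl_act +%R.
Proof.
move=> a u v; apply: (can_inj (@coordsK k _)).
by rewrite coords_act !linearD /= !coords_act.
Qed.
Fact kl_actDl v : {morph kl_act^~ v : a b / a + b}.
Proof.
move=> a b; apply: (can_inj (@coordsK k _)).
by rewrite coords_act !linearD /= !coords_act rmorphD linearD mulmxDl.
Qed.
HB.instance Definition _ := GRing.Zmodule_isLmodule.Build A M
  kl_actA kl_act1 kl_actDr kl_actDl.

Lemma kl_module_findim : finite_dimensional (scalar_restriction M).
Proof.
exists #|kl_set X|; constructor.
exists (fun v : M => (coords v)^T).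
  move=> c u v; rewrite !linearD /=; congr (_ + _).
  rewrite coords_act -[alg_scalar A c]mulr1 kl_rep_scalar rmorph1.
  by rewrite linearZ /= Phi_one -scalemxAl mul1mx linearZ.
exists (fun w => of_coords w^T) => [v|w]; first by rewrite trmxK coordsK.
by rewrite of_coordsK trmxK.
Qed.

Definition F_obj : rep A := RepObj kl_module_findim.
End KlModule.

Section KlMap.
Variables (X Y : kl_rep) (f : kl_hom X Y).

Definition kl_map (v : kl_module X) : kl_module Y :=
  kl_bind (kl_hom_arrow f) v.

Fact kl_map_linear : linear kl_map.
Proof.
have /asboolP Hf := kl_homP f.
move=> a u v; apply: (can_inj (@coordsK k _)).
rewrite coords_bind !linearD /= !coords_act !coords_bind.
by rewrite !mulmxA Hf.
Qed.
HB.instance Definition _ :=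
  GRing.isLinear.Build A (kl_module X) (kl_module Y) *:%R kl_map kl_map_linear.

Definition F_mor : module_hom (kl_module X) (kl_module Y) := kl_map.
End KlMap.

Program Definition F_functor : linfunctor Klcrep (rep A) :=
  @LinFunctor k Klcrep (rep A) F_obj F_mor _ _ _.
Next Obligation.
move=> X Y a f g; apply: module_homP => v; apply: (can_inj (@coordsK k _)).
rewrite [LHS]coords_bind kl_hom_arrowP [RHS]linearD /=.
rewrite [X in _ = X + _]coords_act !coords_bind.
rewrite -[alg_scalar A a]mulr1 kl_rep_scalar rmorph1 linearZ /= Phi_one.
by rewrite -scalemxAl mul1mx linearP mulmxDl scalemxAl.
Qed.
Next Obligation.
move=> X; apply: module_homP => v; apply: (can_inj (@coordsK k _)).
by rewrite /= coords_bind kl_mx_id mul1mx.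
Qed.
Next Obligation.
move=> X Y Z g f; apply: module_homP => v; apply: (can_inj (@coordsK k _)).
by rewrite /= !coords_bind kl_mx_comp mulmxA.
Qed.

Definition is_injective_kl_rep (X : Klcrep) : Prop := is_injective_rep (F_functor X).

Definition Klcrep_inj : lincat k := full_subcat is_injective_kl_rep.

Definition F_inj : linfunctor Klcrep_inj (inj A) :=
  restrict_functor F_functor
    (fun X (injX : is_injective_kl_rep X) => injX).
End Klcrep.

(* Main.v *)
From HB Require Import structures.
From mathcomp Require Import all_boot all_algebra.
From mathcomp Require Import boolp monalg.
Require Import Defs.

(** A fully faithful linear functor that reaches every object up to isomorphism
    is an equivalence, so it suffices to see that [F_inj] has these two
    properties.

    Full faithfulness is inherited from [F_functor], the subcategories being
    full.  On morphisms [F_functor] sends a Kleisli arrow to its linear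
    extension; since the formal sums [[x]] are a basis, a module map [g] is the
    extension of exactly one arrow, namely [x |-> g [x]], and the intertwining
    condition on this arrow is the [A]-linearity of [g] read in coordinates
    ([F_functor_faithful], [F_functor_full]).

    For essential surjectivity, a basis of a finite-dimensional module [M],
    indexed by ['I_n], turns the action of each [a : A] into a matrix; as [Phi]
    is an isomorphism onto matrices, this defines a Kleisli convolution
    representation whose module is [M] up to isomorphism
    ([F_functor_ess_surj]).  Injectivity of modules is invariant under
    isomorphism ([is_injective_rep_iso]), so when [M] is injective this
    representation is injective too. *)

Set Implicit Arguments.
Unset Strict Implicit.
Unset Printing Implicit Defensive.

Import GRing.Theory.
Local Open Scope ring_scope.
Local Open Scope lincat_scope.

(** * Recognizing equivalences of linear categories *)

Definition faithful (k : fieldType) (C D : lincat k) (F : linfunctor C D) :=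
  forall x y : C, injective (@fmor k C D F x y).

Definition full (k : fieldType) (C D : lincat k) (F : linfunctor C D) :=
  forall (x y : C) (g : hom (F x) (F y)), exists f : hom x y, fmor F f = g.

Definition ess_surj (k : fieldType) (C D : lincat k) (F : linfunctor C D) :=
  forall d : D, exists (c : C) (e : hom (F c) d), is_iso e.

(** Choosing for each [d] an object [G d] and an isomorphism
    [e d : F (G d) -> d] forces the rest: [G f] is the unique arrow that [F]
    sends to [e^-1 f e], which makes [e] natural, and the isomorphism
    [G (F x) -> x] is the unique arrow that [F] sends to [e (F x)]. *)
Lemma fully_faithful_ess_surj_equivalence (k : fieldType) (C D : lincat k)
    (F : linfunctor C D) :
  faithful F -> full F -> ess_surj F -> is_equivalence F.
Proof.
move=> Finj Fsurj Fess.
have [G0 [e [i [ie ei]]]] : exists (G0 : D -> C)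
    (e : forall d, hom (F (G0 d)) d) (i : forall d, hom d (F (G0 d))),
    (forall d, i d \oc e d = idm _) /\ (forall d, e d \oc i d = idm d).
  pose h d := cid (Fess d); pose h' d := cid (projT2 (h d)).
  pose h'' d := cid (projT2 (h' d)).
  exists (fun d => projT1 (h d)), (fun d => projT1 (h' d)).
  exists (fun d => projT1 (h'' d)).
  by split=> d; case: (projT2 (h'' d)).
pose lift x y (g : hom (F x) (F y)) : hom x y := projT1 (cid (Fsurj x y g)).
have liftK x y (g : hom (F x) (F y)) : fmor F (lift x y g) = g.
  exact: projT2 (cid (Fsurj x y g)).
pose G1 d d' (f : hom d d') := lift _ _ (i d' \oc f \oc e d).
have FG1 d d' (f : hom d d') : fmor F (G1 d d' f) = i d' \oc f \oc e d.
  exact: liftK.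
have G1_linear d d' : linear (G1 d d').
  move=> a f g; apply: Finj; rewrite fmor_linear !FG1.
  by rewrite comp_linear_r comp_linear_l.
have G1_id d : G1 d d (idm d) = idm (G0 d).
  by apply: Finj; rewrite FG1 compm1 ie fmor1.
have G1M x y z (g : hom y z) (f : hom x y) :
    G1 x z (g \oc f) = G1 y z g \oc G1 x y f.
  apply: Finj; rewrite fmorM !FG1 -!compA; congr (_ \oc (_ \oc _)).
  by rewrite !compA ei comp1m.
exists (LinFunctor G1_linear G1_id G1M); split.
- exists (fun x => lift _ _ (e (F x))); split=> [x|x y f] /=.
    exists (lift _ _ (i (F x))).
    by split; apply: Finj; rewrite fmorM fmor1 !liftK.
  by apply: Finj; rewrite !fmorM FG1 !liftK !compA ei comp1m.
- exists e; split=> [d|d d' f] /=; first by exists (i d).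
  by rewrite FG1 !compA ei comp1m.
Qed.

Lemma restrict_functor_faithful (k : fieldType) (C D : lincat k)
    (F : linfunctor C D) (P : C -> Prop) (Q : D -> Prop)
    (PQ : forall x, P x -> Q (F x)) :
  faithful F -> faithful (restrict_functor F PQ).
Proof. by move=> Finj [x Px] [y Py]; apply: Finj. Qed.

Lemma restrict_functor_full (k : fieldType) (C D : lincat k)
    (F : linfunctor C D) (P : C -> Prop) (Q : D -> Prop)
    (PQ : forall x, P x -> Q (F x)) :
  full F -> full (restrict_functor F PQ).
Proof. by move=> Fsurj [x Px] [y Py]; apply: Fsurj. Qed.

(** The object found for [d] has to lie in [P], for which it is enough that [P]
    be pulled back from [Q] and that [Q] be invariant under isomorphism. *)
Lemma restrict_functor_ess_surj (k : fieldType) (C D : lincat k)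
    (F : linfunctor C D) (P : C -> Prop) (Q : D -> Prop)
    (PQ : forall x, P x -> Q (F x)) :
  (forall x, Q (F x) -> P x) ->
  (forall (d d' : D) (e : hom d d'), is_iso e -> Q d' -> Q d) ->
  ess_surj F -> ess_surj (restrict_functor F PQ).
Proof.
move=> QP Qiso Fess [d Qd]; have [c [e e_iso]] := Fess d.
by exists (exist P c (QP _ (Qiso _ _ _ e_iso Qd))), e.
Qed.

(** * Invariance of injective modules *)

(** An extension problem for [P] is solved in [Q] and brought back by [e'], so
    it is enough that [P] be a retract of [Q]. *)
Lemma injective_module_retract (R : pzRingType) (P Q : lmodType R)
    (e : {linear P -> Q}) (e' : {linear Q -> P}) :
  cancel e e' -> injective_module Q -> injective_module P.
Proof.
move=> eK injQ M N i f i_inj.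
have [g gi] := injQ M N i (e \o f : {linear M -> Q}) i_inj.
exists (e' \o g : {linear N -> P}) => x /=.
by rewrite gi /= eK.
Qed.

Lemma is_injective_rep_iso (k : fieldType) (A : algebra k) (M N : rep A)
    (e : hom M N) :
  is_iso e -> is_injective_rep N -> is_injective_rep M.
Proof.
case=> e' [e'e _]; apply: (@injective_module_retract A _ _ e e') => v.
exact: (congr1 (fun f : module_hom M M => f v) e'e).
Qed.

(** * Full faithfulness *)

(** The module [kl_module X] carries two scalar multiplications by [k], the one
    of formal sums and the one through [k -> A]; they agree because
    [kl_theta X] is [k]-linear. *)
Lemma kl_module_scalar (k : fieldType) (A : algebra k) (X : kl_rep A)
    (c : k) (v : kl_module X) :
  alg_scalar A c *: v = c *: (v : {malg k[kl_set X]}).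
Proof.
apply: (can_inj (@coordsK k _)); rewrite coords_act linearZ /=.
rewrite -[alg_scalar A c]mulr1 kl_rep_scalar rmorph1.
by rewrite linearZ /= Phi_one -scalemxAl mul1mx.
Qed.

Lemma F_functor_faithful (k : fieldType) (A : algebra k) :
  faithful (F_functor A).
Proof.
move=> X Y f g fg; apply: val_inj; apply: kl_mx_inj.
apply: trmx_inj; apply/row_matrixP=> j; rewrite -!tr_col !colE.
rewrite -[delta_mx j 0]of_coordsK -!coords_bind.
by congr (coords _)^T; exact: (congr1
  (fun h : module_hom (kl_module X) (kl_module Y) => h (of_coords _)) fg).
Qed.

(** A module map is [k]-linear for the scalars of formal sums, hence the linear
    extension of its values on the basis of the [[x]]. *)
Lemma kl_bind_basis (k : fieldType) (A : algebra k) (X Y : kl_rep A)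
    (g : {linear kl_module X -> kl_module Y}) (v : kl_module X) :
  kl_bind (Y := kl_set Y) (fun x => g << x >>) v = g v.
Proof.
rewrite kl_bindE -[in RHS](coordsK v) /of_coords.
rewrite (raddf_sum g); apply: eq_bigr => x _.
rewrite mxE enum_rankK -[LHS]kl_module_scalar -linearZ /=; congr (g _).
rewrite kl_module_scalar; apply/malgP=> y.
by rewrite mcoeffZ !mcoeffU; case: eqP; rewrite ?mulr1n ?mulr0n ?mulr1 ?mulr0.
Qed.

(** Linear maps that agree on vectors have the same matrix, so the intertwining
    relation is checked on the standard basis vectors, read as coordinates of
    formal sums. *)
Lemma F_functor_full (k : fieldType) (A : algebra k) : full (F_functor A).
Proof.
move=> X Y g; pose f : kl_arrow k (kl_set X) (kl_set Y) :=
  [ffun x => (g : {linear _ -> _}) << x >>].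
have fE v : kl_bind f v = (g : {linear _ -> _}) v.
  rewrite -kl_bind_basis !kl_bindE; apply: eq_bigr => x _.
  by rewrite ffunE.
have f_int : f \in @kl_intertwines _ _ X Y.
  apply/asboolP=> a; apply: trmx_inj; apply/row_matrixP=> j.
  rewrite -!tr_col !colE -!mulmxA -[delta_mx j 0]of_coordsK; congr (_^T).
  by rewrite -coords_bind fE -!coords_act -coords_bind fE linearZ.
by exists (KlHom f_int); apply: module_homP => v; exact: fE.
Qed.

(** * Essential surjectivity *)

Definition of_Phi (k : fieldType) (X : finType) (P : 'M[k]_#|X|) :
    kl_conv_alg k X :=
  [ffun=> \sum_x \sum_y << P (enum_rank x) (enum_rank y) *g (x, y) >>].

Lemma of_PhiK (k : fieldType) (X : finType) : cancel (@of_Phi k X) (@Phi k X).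
Proof.
move=> P; apply/matrixP=> i j; rewrite !mxE ffunE raddf_sum /=.
rewrite (bigD1 (enum_val i)) //= raddf_sum /= (bigD1 (enum_val j)) //=.
rewrite mcoeffUU !enum_valK big1 ?addr0; last first.
  by move=> y /negPf ny; rewrite mcoeffU xpair_eqE ny andbF mulr0n.
rewrite big1 ?addr0 // => x /negPf nx; rewrite raddf_sum big1 // => y _ /=.
by rewrite mcoeffU xpair_eqE nx mulr0n.
Qed.

Section BasisRep.
Context {k : fieldType} {A : algebra k} (X : finType) (M : lmodType A).
Context (r : {linear scalar_restriction M -> 'rV[k]_#|X|}).
Context (s : 'rV[k]_#|X| -> scalar_restriction M).
Hypotheses (rK : cancel r s) (sK : cancel s r).

Definition basis_act (a : A) (w : 'rV[k]_#|X|) : 'rV[k]_#|X| :=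
  r (a *: (s w : M) : M).

Fact basis_act_linear a : linear (basis_act a).
Proof.
move=> c u v; rewrite /basis_act.
have -> : s (c *: u + v) = c *: s u + s v.
  by apply: (can_inj rK); rewrite linearP !sK.
rewrite -linearP; congr (r _).
rewrite [LHS]scalerDr; congr (_ + _).
by rewrite [LHS]scalerA -alg_scalarC -scalerA.
Qed.
HB.instance Definition _ a :=
  GRing.isLinear.Build k 'rV[k]_#|X| 'rV[k]_#|X| *:%R (basis_act a)
    (basis_act_linear a).

(** The transpose is there because linear maps act on row vectors by
    multiplication on the right, whereas [Phi] is an action on columns. *)
Definition basis_mx (a : A) : 'M[k]_#|X| := (lin1_mx (basis_act a))^T.

Lemma basis_mxE a (m : M) : basis_mx a *m (r m)^T = (r (a *: m))^T.
Proof. by rewrite -trmx_mul mul_rV_lin1 /= /basis_act rK. Qed.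

(** Every column vector is the coordinate vector of an element of [M], so the
    matrices are determined by the action on [M]. *)
Lemma basis_mx_ext (P Q : 'M[k]_#|X|) :
  (forall m, P *m (r m)^T = Q *m (r m)^T) -> P = Q.
Proof.
move=> PQ; apply: trmx_inj; apply/row_matrixP=> j; rewrite -!tr_col !colE.
by have := PQ (s (delta_mx j 0)^T); rewrite sK trmxK => ->.
Qed.

Definition basis_theta (a : A) : kl_conv_alg k X := of_Phi (basis_mx a).

Fact basis_theta_additive : zmod_morphism basis_theta.
Proof.
move=> a b; apply: Phi_inj; rewrite linearB /= !of_PhiK.
apply: basis_mx_ext => m.
by rewrite mulmxBl !basis_mxE scalerBl !linearB.
Qed.
Fact basis_theta_multiplicative : monoid_morphism basis_theta.
Proof.
split=> [|a b]; apply: Phi_inj; rewrite ?[Phi (_ * _)]Phi_conv ?Phi_one !of_PhiK;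
  apply: basis_mx_ext => m.
  by rewrite basis_mxE scale1r mul1mx.
by rewrite -mulmxA !basis_mxE scalerA.
Qed.
HB.instance Definition _ :=
  GRing.isZmodMorphism.Build A (kl_conv_alg k X) basis_theta
    basis_theta_additive.
HB.instance Definition _ :=
  GRing.isMonoidMorphism.Build A (kl_conv_alg k X) basis_theta
    basis_theta_multiplicative.

Fact basis_theta_scalar c a :
  basis_theta (alg_scalar A c * a) = c *: basis_theta a.
Proof.
apply: Phi_inj; rewrite linearZ /= !of_PhiK; apply: basis_mx_ext => m.
rewrite -scalemxAl !basis_mxE -scalerA -linearZ /=; congr (_^T).
exact: (linearZ_LR r).
Qed.

Definition basis_kl_rep : kl_rep A :=
  KlRep (kl_theta := basis_theta) basis_theta_scalar.

Definition basis_iso (v : kl_module basis_kl_rep) : M := s (coords v)^T.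
Definition basis_iso_inv (m : M) : kl_module basis_kl_rep :=
  of_coords (r m)^T.

Lemma basis_isoK : cancel basis_iso basis_iso_inv.
Proof. by move=> v; rewrite /basis_iso_inv sK trmxK coordsK. Qed.

Lemma basis_iso_invK : cancel basis_iso_inv basis_iso.
Proof. by move=> m; rewrite /basis_iso of_coordsK trmxK rK. Qed.

Fact basis_iso_inv_linear : linear basis_iso_inv.
Proof.
move=> a u v; apply: (can_inj (@coordsK k X)).
rewrite [RHS]linearD /= [X in _ = X + _](@coords_act _ _ basis_kl_rep).
by rewrite !of_coordsK !linearD /= of_PhiK basis_mxE.
Qed.
HB.instance Definition _ :=
  GRing.isLinear.Build A M (kl_module basis_kl_rep) *:%R basis_iso_inv
    basis_iso_inv_linear.

Fact basis_iso_linear : linear basis_iso.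
Proof.
move=> a u v; apply: (can_inj basis_iso_invK).
by rewrite linearP /= !basis_isoK.
Qed.
HB.instance Definition _ :=
  GRing.isLinear.Build A (kl_module basis_kl_rep) M *:%R basis_iso
    basis_iso_linear.
End BasisRep.

Lemma F_functor_ess_surj (k : fieldType) (A : algebra k) :
  ess_surj (F_functor A).
Proof.
move=> M; have [n [ax]] := rep_findim M.
(* Matrices over the set ['I_n] are indexed by its cardinal, which is equal
   to [n] but not by computation. *)
rewrite -(card_ord n) in ax; case: ax => r0 r0_lin [s r0K sK].
pose rL := GRing.isLinear.Build k _ _ *:%R r0 r0_lin.
pose r : {linear _ -> _} := HB.pack r0 rL.
have rK : cancel r s := r0K; have {}sK : cancel s r := sK.
exists (basis_kl_rep rK sK), (@basis_iso _ _ _ _ _ _ rK sK : {linear _ -> _}).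
exists (@basis_iso_inv _ _ _ _ _ _ rK sK : {linear _ -> _}).
split; apply: module_homP => v; first exact: basis_isoK.
exact: basis_iso_invK.
Qed.

Theorem proposition6p9 (k : fieldType) (A : algebra k)
    (hA : finite_dimensional_algebra A) :
  is_equivalence (F_inj A).
Proof.
apply: fully_faithful_ess_surj_equivalence.
- by apply: restrict_functor_faithful; exact: F_functor_faithful.
- by apply: restrict_functor_full; exact: F_functor_full.
- apply: restrict_functor_ess_surj; [by []| |exact: F_functor_ess_surj].
  exact: is_injective_rep_iso.
Qed.
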